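(* There are a dense subset $X$ of $\mathbb{R}$ with $|X|=2^{\aleph_0}$, ordered by the restriction of the usual order of $\mathbb{R}$, and a non-identity epimorphism $f$ of $(X,\le)$, such that $(X,\le)$ is automorphism-rigid and every non-identity member of $\mathrm{Epi}(X,\le)$ is generated from $f$ in a wide sense.
   Context: The axiom of choice is assumed. For a chain (linearly ordered set) $(X,\le)$, an epimorphism is a surjective map $f:X\to X$ with $x\le y\Rightarrow f(x)\le f(y)$, and $\mathrm{Epi}(X,\le)$ is the monoid of all epimorphisms. $(X,\le)$ is automorphism-rigid if its only order-automorphism is the identity. Generated in a wide sense (epimorphisms). Let $X\subseteq\mathbb{R}$ be dense and $f\in\mathrm{Epi}(X,\le)$. An epimorphism $g$ of $(X,\le)$ is said to be upward generated from $f$ if there is a sequence $a_0<a_1<a_2<\cdots$ in $X$ with $f(a_{n+1})=a_n$ for all $n\in\mathbb{N}$, such that, writing $s=\sup_n a_n\in\mathbb{R}\cup\{+\infty\}$, one of the following holds (all intervals are intersected with $X$; $f^k$ is the $k$-fold composite; $K_n:=k_0+k_1+\cdots+k_{n-1}$, so $K_0=0$ and $f^{K_0}$ is the identity): (i) (infinite form) there are points $b_0<b_1<b_2<\cdots$ of $X$ in $[a_0,s)$ and integers $k_n\ge 1$ with $f^{k_n}(b_{2n+1})=b_{2n}$ for all $n\in\mathbb{N}$, with $\sup\{f^{K_n}(b_{2n}): n\in\mathbb{N}\}=s$, such that $g$ fixes all points of $X$ not in $\bigcup_{n}[b_n,b_{n+1}]$, and for every $n\in\mathbb{N}$, $g(x)=f^{K_n}(b_{2n})$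 if $b_{2n}\le x\le b_{2n+1}$, and $g(x)=f^{K_{n+1}}(x)$ if $b_{2n+1}\le x\le b_{2n+2}$; (ii) (finite form) there are $N\ge1$, points $b_0<b_1<\cdots<b_{2N-1}$ of $X$ in $[a_0,s)$, and integers $k_n\ge1$ with $f^{k_n}(b_{2n+1})=b_{2n}$ for $0\le n<N$, such that, putting $b_{2N}=s$ (possibly $+\infty$), $g$ fixes all points of $X$ not in $\bigcup_{0\le n<2N}[b_n,b_{n+1}]$, and for $0\le n<N$, $g(x)=f^{K_n}(b_{2n})$ if $b_{2n}\le x\le b_{2n+1}$, and $g(x)=f^{K_{n+1}}(x)$ if $b_{2n+1}\le x\le b_{2n+2}$. An epimorphism $g$ is generated from $f$ in a wide sense if it is upward generated from $f$, or if the same holds with the order of $X$ reversed (i.e. $x\mapsto -g(-x)$ is upward generated from $x\mapsto -f(-x)$ on $-X=\{-x:x\in X\}$). *)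

(* Defs.v *)
From mathcomp Require Import all_boot all_order all_algebra.
From mathcomp Require Import all_classical all_reals all_analysis.

Set Implicit Arguments.
Unset Strict Implicit.
Unset Printing Implicit Defensive.

Import Order.TTheory GRing.Theory Num.Theory.
Import numFieldNormedType.Exports.

Local Open Scope classical_set_scope.
Local Open Scope ring_scope.

(* A self-map of the chain [X : set R] is represented by a function [R -> R];
   only its restriction to [X] is ever constrained or used. *)

Definition epimorphism (R : realType) (X : set R) (f : R -> R) : Prop :=
  [/\ set_fun X X f, set_surj X X f & {in X &, {homo f : x y / x <= y}}].

Definition automorphism (R : realType) (X : set R) (h : R -> R) : Prop :=
  set_bij X X h /\ {in X &, {mono h : x y / x <= y}}.

Definition automorphism_rigid (R : realType) (X : set R) : Prop :=
  forall h : R -> R, automorphism X h -> {in X, h =1 id}.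

Definition partial_sum (k : nat -> nat) (n : nat) : nat :=
  (\sum_(i < n) k i)%N.

Definition infinite_form (R : realType) (X : set R) (f g : R -> R)
    (a0 : R) (s : \bar R) : Prop :=
  exists (b : nat -> R) (k : nat -> nat),
    let K := partial_sum k in
    (forall n, b n < b n.+1) /\
    (forall n, [/\ X (b n), a0 <= b n & ((b n)%:E < s)%E]) /\
    (forall n, (1 <= k n)%N) /\
    (forall n, iter (k n) f (b (2 * n + 1)%N) = b (2 * n)%N) /\
    ereal_sup (range (fun n => (iter (K n) f (b (2 * n)%N))%:E)) = s /\
    (forall x, X x -> ~ (exists n, b n <= x <= b n.+1) -> g x = x) /\
    (forall n x, X x -> b (2 * n)%N <= x <= b (2 * n + 1)%N ->
       g x = iter (K n) f (b (2 * n)%N)) /\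
    (forall n x, X x -> b (2 * n + 1)%N <= x <= b (2 * n + 2)%N ->
       g x = iter (K n.+1) f x).

(* Only [b i] for [i < 2 * N] and [k n] for [n < N] matter; [c] is the list of
   all 2N + 1 endpoints, the last of which is [s], possibly infinite. *)
Definition finite_form (R : realType) (X : set R) (f g : R -> R)
    (a0 : R) (s : \bar R) : Prop :=
  exists (N : nat) (b : nat -> R) (k : nat -> nat),
    let K := partial_sum k in
    let c := fun i : nat => if (i < 2 * N)%N then (b i)%:E else s in
    (1 <= N)%N /\
    (forall i, (i.+1 < 2 * N)%N -> b i < b i.+1) /\
    (forall i, (i < 2 * N)%N ->
       [/\ X (b i), a0 <= b i & ((b i)%:E < s)%E]) /\
    (forall n, (n < N)%N -> (1 <= k n)%N) /\
    (forall n, (n < N)%N -> iter (k n) f (b (2 * n + 1)%N) = b (2 * n)%N) /\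
    (forall x, X x ->
       ~ (exists2 i, (i < 2 * N)%N & (c i <= x%:E <= c i.+1)%E) -> g x = x) /\
    (forall n x, (n < N)%N -> X x ->
       (c (2 * n)%N <= x%:E <= c (2 * n + 1)%N)%E ->
       g x = iter (K n) f (b (2 * n)%N)) /\
    (forall n x, (n < N)%N -> X x ->
       (c (2 * n + 1)%N <= x%:E <= c (2 * n + 2)%N)%E ->
       g x = iter (K n.+1) f x).

Definition upward_generated (R : realType) (X : set R) (f g : R -> R) : Prop :=
  exists a : nat -> R,
    let s := ereal_sup (range (fun n => (a n)%:E)) in
    [/\ forall n, X (a n),
        forall n, a n < a n.+1,
        forall n, f (a n.+1) = a n
      & infinite_form X f g (a 0%N) s \/ finite_form X f g (a 0%N) s].

Definition generated_wide (R : realType) (X : set R) (f g : R -> R) : Prop :=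
  upward_generated X f g \/
  upward_generated [set - x | x in X] (fun x => - f (- x)) (fun x => - g (- x)).

(* Main.v *)
(** Let [stall] be the identity on the negatives, 0 on [0, 1] and [x - 1] from 1
    on.  Two points are in the same orbit if they are equal, or both nonnegative
    with integral difference.  A nondecreasing surjection [G] of the line is
    evasive if on some interval that it does not collapse it moves every point
    out of its orbit.  There are continuum many evasive maps, and such an
    interval has continuum many images, so a transfinite recursion of length
    continuum yields a union [X] of orbits, containing the rationals, such that
    every evasive map sends some point of [X] outside [X].

    An epimorphism of [X] therefore extends to a nondecreasing surjection [G]
    that is not evasive.  Such a [G] is the identity on the negatives.  On the
    nonnegatives [G] is constant wherever the gap [x - G x] is not an integer,
    so the gap is nondecreasing and climbs from each integer to the next along
    a plateau of [G] of length exactly 1.  Merging adjacent plateaus gives the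
    form required of a map generated from [stall] along 0, 1, 2, ...; an
    automorphism has no plateau at all. *)
Require Import Defs.
From mathcomp Require Import all_boot all_order all_algebra.
From mathcomp Require Import all_classical all_reals all_analysis.
From mathcomp Require Import ring lra zify.
Import Order.TTheory GRing.Theory Num.Theory.
Import numFieldNormedType.Exports.
Local Open Scope classical_set_scope.
Local Open Scope card_scope.
Local Open Scope ring_scope.

(** * Well-orders and transfinite choice *)

Lemma well_order_wf (T : Type) :
  exists lt : T -> T -> Prop,
    well_founded lt /\ forall x y, x <> y -> lt x y \/ lt y x.
Proof.
have [L wL] := @wochoice.well_ordering_principle {classic T}.
have Lxx x : L x x.
  have [|z [[/eqP -> zmin] _]] := wL (pred1 x); first by exists x; exact: eqxx.
  exact/zmin/eqxx.
(* The strict order is the negation of the reversed weak one. Two points each weakly below the other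
   are both minima of their pair, hence equal because minima are unique. *)
exists (fun x y => ~~ L y x); split=> [x|x y xy].
  apply: contrapT => nx.
  have [|z [[/asboolP nz zmin] _]] := wL (fun x => `[< ~ Acc (fun x y => ~~ L y x) x >]).
    by exists x; apply/asboolP.
  apply: nz; constructor => y zy; apply: contrapT => ny; case/negP: zy.
  exact/zmin/asboolP.
apply/orP; rewrite -negb_and; apply/negP => /andP[Lyx Lxy].
have [|z [_ zu]] := wL (pred2 (x : {classic T}) y); first by exists x; rewrite inE eqxx.
apply: xy; transitivity z.
  by apply/esym/zu; split=> [|t /orP[]/eqP->]; rewrite ?inE ?eqxx.
by apply/zu; split=> [|t /orP[]/eqP->]; rewrite ?inE ?eqxx ?orbT.
Qed.

(** This is an order of least possible length. If some initial segment maps onto [T], take a first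
    point [x] whose segment does, and pull the order back along a section of that surjection: new
    segments then embed in old segments cut at points before [x]. *)
Lemma well_order_small_segments (T : Type) :
  exists lt : T -> T -> Prop,
    [/\ well_founded lt, forall x y, x <> y -> lt x y \/ lt y x &
        forall (x : T) (p : T -> T), ~ set_surj [set y | lt y x] setT p].
Proof.
have [lt [wf tri]] := well_order_wf T.
pose big x := exists p : T -> T, set_surj [set y | lt y x] setT p.
have [[x0 x0big]|nobig] := pselect (exists x, big x); last first.
  by exists lt; split=> // x p ps; apply: nobig; exists x, p.
have [x [[p ps] xmin]] : exists x, big x /\ forall y, lt y x -> ~ big y.
  elim: (wf x0) x0big => {}x0 _ IH x0big.
  have [[y [yx ybig]]|n] := pselect (exists y, lt y x0 /\ big y).
    exact: IH ybig.
  by exists x0; split=> // y yx ybig; apply: n; exists y.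
have /choice [r rP] : forall t, exists y, lt y x /\ p y = t.
  by move=> t; have [y /= yx <-] := ps t I; exists y.
exists (fun t u => lt (r t) (r u)); split.
- move=> t; have [y rt] : exists y, r t = y by exists (r t).
  elim: {y}(wf y) t rt => y _ IH t rt; constructor => u ut.
  by apply: (IH (r u)); rewrite -?rt.
- move=> t u tu; apply: tri => rtu; apply: tu.
  by rewrite -(rP t).2 -(rP u).2 rtu.
- move=> u q qs; apply: (xmin (r u) (rP u).1).
  exists (q \o p) => v _; have [t /= tu <-] := qs v I.
  by exists (r t) => //=; rewrite (rP t).2.
Qed.

Lemma transfinite_choice (T : Type) (V : pointedType) (lt : T -> T -> Prop)
    (P : T -> set V -> V -> Prop) :
  well_founded lt ->
  (forall a (h : T -> V), exists v, P a (h @` [set b | lt b a]) v) ->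
  exists h : T -> V, forall a, P a (h @` [set b | lt b a]) (h a).
Proof.
move=> wf ex.
pose step a (prev : forall b, lt b a -> V) :=
  get (P a [set v | exists b (ba : lt b a), prev b ba = v]).
pose h := Fix wf (fun=> V) step; exists h => a.
have hE : h a = step a (fun b _ => h b).
  rewrite /h Fix_eq // => x p q pq; rewrite /step; congr (get (P x _)).
  by apply/seteqP; split=> v [b [bx <-]]; exists b, bx; rewrite pq.
rewrite hE; set A := h @` _.
suff -> : step a (fun b _ => h b) = get (P a A) by have [v /getI] := ex a h.
congr (get (P a _)); apply/seteqP; split=> v.
  by move=> [b [ba <-]]; exists b.
by move=> [b ba <-]; exists b, ba.
Qed.

(* Diagonalize: if no [A z] projected onto all of [T] at coordinate [pickle z],
   one sequence would avoid them all. *)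
Lemma koenig (T : pointedType) (V : Type) (I : countType)
    (i : (nat -> T) -> V) (A : I -> set V) :
  injective i -> range i `<=` \bigcup_z A z ->
  exists z (p : V -> T), set_surj (A z) setT p.
Proof.
move=> inj_i cov; apply: contrapT => none.
have /choice [t tP] : forall z, exists t, ~ exists v, A z (i v) /\ v (pickle z) = t.
  move=> z; apply: contrapT => /forallNP nd; apply: none; exists z.
  have /choice [q qP] : forall v, exists t, forall w, i w = v -> w (pickle z) = t.
    move=> v; have [[w <-]|nw] := pselect (exists w, i w = v).
      by exists (w (pickle z)) => w' /inj_i ->.
    by exists point => w wv; case: nw; exists w.
  exists q => s _; have [w [Aw <-]] := contrapT (nd s).
  by exists (i w) => //; apply/esym/qP.
pose d n := if unpickle n is Some z then t z else point.
have [z _ Azd] := cov (i d) (ex_intro2 _ _ d Logic.I erefl).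
by apply: (tP z); exists d; rewrite /d pickleK.
Qed.

(** * Coding by binary sequences *)

Section CantorSum.
Variables (R : realType).
Implicit Types (t u : nat -> bool).

(** Digits 0 and 1 in base 3: all digits after a given place add up to at most half the weight of
    that place, so distinct sequences give distinct reals. *)
Definition ternary_sum t n : R := \sum_(i < n) (t i)%:R * 3^-1 ^+ i.
Definition ternary t : R := sup (range (ternary_sum t)).

Lemma ternary_sumS t n :
  ternary_sum t n.+1 = ternary_sum t n + (t n)%:R * 3^-1 ^+ n.
Proof. by rewrite /ternary_sum big_ord_recr. Qed.

Lemma ternary_sum_le t n m : (n <= m)%N -> ternary_sum t n <= ternary_sum t m.
Proof.
elim: m => [|m IH]; first by rewrite leqn0 => /eqP->.
rewrite leq_eqVlt => /predU1P[->//|/IH/le_trans]; apply.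
by rewrite ternary_sumS lerDl mulr_ge0 ?exprn_ge0 ?invr_ge0.
Qed.

(** The added term is what the remaining digits contribute when all are 1, so reading an actual
    digit can only lower the total. *)
Lemma ternary_sum_tail t n m : (n <= m)%N ->
  ternary_sum t m + 3 / 2 * 3^-1 ^+ m <= ternary_sum t n + 3 / 2 * 3^-1 ^+ n.
Proof.
elim: m => [|m IH]; first by rewrite leqn0 => /eqP->.
rewrite leq_eqVlt => /predU1P[->//|/IH]; apply: le_trans.
have w0 : 0 < 3^-1 ^+ m :> R by rewrite exprn_gt0 ?invr_gt0.
by rewrite ternary_sumS exprS; case: (t m) => /=; lra.
Qed.

Lemma ternary_le t n : ternary t <= ternary_sum t n + 3 / 2 * 3^-1 ^+ n.
Proof.
apply: ge_sup; first by exists (ternary_sum t 0), 0%N.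
move=> _ [m _ <-]; have w k : 0 < 3^-1 ^+ k :> R by rewrite exprn_gt0 ?invr_gt0.
case: (leqP n m) => [/(ternary_sum_tail t)|/ltnW/(ternary_sum_le t)].
  by have := w m; lra.
by have := w n; lra.
Qed.

Lemma le_ternary t n : ternary_sum t n <= ternary t.
Proof.
apply: ub_le_sup; last by exists n.
exists (3 / 2) => _ [m _ <-]; have := @ternary_sum_tail t 0 m erefl.
have w k : 0 < 3^-1 ^+ k :> R by rewrite exprn_gt0 ?invr_gt0.
by rewrite {2}/ternary_sum big_ord0 expr0; have := w m; lra.
Qed.

Lemma ternary_itv t : 0 <= ternary t <= 3 / 2.
Proof.
have := le_ternary t 0; have := ternary_le t 0.
by rewrite /ternary_sum big_ord0 expr0 => ? ?; apply/andP; split; lra.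
Qed.

Lemma ternary_inj : injective ternary.
Proof.
suff lt t u n : (forall i, (i < n)%N -> t i = u i) -> t n = false ->
    u n = true -> ternary t < ternary u.
  move=> t u tu; apply/funext => n; elim/ltn_ind: n => n IH.
  have IH' i : (i < n)%N -> u i = t i by move=> /IH.
  case tn: (t n); case un: (u n) => //.
    by have := lt _ _ _ IH' un tn; rewrite tu ltxx.
  by have := lt _ _ _ IH tn un; rewrite tu ltxx.
move=> tu tn un; have := ternary_le t n.+1; have := le_ternary u n.+1.
rewrite !ternary_sumS tn un exprS.
have -> : ternary_sum t n = ternary_sum u n.
  by apply: eq_bigr => i _; rewrite tu.
have w0 : 0 < 3^-1 ^+ n :> R by rewrite exprn_gt0 ?invr_gt0.
by rewrite mulr1n mulr0n; lra.
Qed.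

End CantorSum.

(** Sequences of binary sequences are coded, so that [koenig] applies with binary sequences as
    [T]. *)
Lemma sequences_inject_itv (R : realType) (a b : R) : a < b ->
  exists i : (nat -> nat -> bool) -> R,
    injective i /\ forall v, a <= i v <= b.
Proof.
move=> ab.
pose code (v : nat -> nat -> bool) n :=
  if unpickle n is Some ij then v ij.1 ij.2 else false.
(* The factor 2/3 compensates for the bound 3/2 on [ternary]. *)
exists (fun v => a + (b - a) * (2 / 3) * ternary R (code v)); split.
  move=> v w /addrI /mulfI vw; apply/funext => i; apply/funext => j.
  have {}vw : code v = code w by apply/ternary_inj/vw; rewrite mulf_neq0 // gt_eqF ?subr_gt0.
  by have := congr1 (@^~ (pickle (i, j))) vw; rewrite /code pickleK.
move=> v; have /andP[t0 t1] := ternary_itv R (code v); apply/andP; split; nra.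
Qed.

Lemma card_real_le (R : realType) (A : set R) : A #<= [set: nat -> bool].
Proof.
pose cut (x : R) n := if unpickle n is Some q then ratr q < x else false.
have lt x y : x < y -> cut x <> cut y.
  move=> /rat_in_itvoo[q]; rewrite in_itv /= => /andP[xq qy].
  by move/(congr1 (@^~ (pickle q))); rewrite /cut pickleK qy ltNge (ltW xq).
apply/pcard_injP; exists cut => x y _ _ xy; apply/eqP; rewrite eq_le !leNgt.
by apply/andP; split; apply/negP => /lt; rewrite xy.
Qed.

(** Decodes [t], read as a set of pairs of rationals, into a function; every monotone surjection
    thereby gets a binary sequence as its index. *)
Definition rational_sup {R : realType} (t : nat -> bool) (x : R) : R :=
  sup [set ratr p | p in [set p : rat |
    exists q : rat, ratr q <= x /\ t (pickle (p, q))]].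

Lemma rational_sup_surj {R : realType} (G : R -> R) :
  {homo G : x y / x <= y} -> set_surj setT setT G ->
  exists t, rational_sup t = G.
Proof.
move=> homoG surjG.
pose t n := if unpickle n is Some (p, q) then ratr p <= G (ratr q) else false.
exists t; apply/funext => x; rewrite /rational_sup.
set A := (X in sup X).
(* Surjectivity gives a point [z] before [x] with value [p]; any rational between [z] and [x] then
   serves as [q]. *)
have inA (p : rat) : ratr p < G x -> A (ratr p).
  have [z _ Gz] := surjG (ratr p) I => px; have : z < x.
    by rewrite ltNge; apply/negP => /homoG; rewrite leNgt Gz px.
  move=> /rat_in_itvoo[q]; rewrite in_itv /= => /andP[zq qx].
  by exists p => //; exists q; split; [exact: ltW|rewrite /t pickleK -Gz homoG// ltW].
have ubA : ubound A (G x).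
  move=> _ [p [q [qx +]] <-]; rewrite /t pickleK => pq.
  exact/(le_trans pq)/homoG.
apply/eqP; rewrite eq_le; apply/andP; split.
  have /rat_in_itvoo[p] : G x - 1 < G x by lra.
  rewrite in_itv /= => /andP[_ px].
  by apply: ge_sup => //; exists (ratr p); exact: inA.
rewrite leNgt; apply/negP => /rat_in_itvoo[p]; rewrite in_itv /= => /andP[+ px].
by rewrite ltNge => /negP; apply; apply: ub_le_sup; [exists (G x)|exact: inA].
Qed.

(** * Orbits, evasive maps and the set [X] *)

Definition same_orbit {R : realType} (x y : R) :=
  x = y \/ [/\ 0 <= x, 0 <= y & exists k : int, y = x + k%:~R].

Definition evasive {R : realType} (G : R -> R) :=
  [/\ {homo G : x y / x <= y}, set_surj setT setT G &
      exists a b, G a < G b /\ forall x, a <= x <= b -> ~ same_orbit x (G x)].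

Lemma monotone_surj_IVT {R : realType} (G : R -> R) (a b v : R) :
  {homo G : x y / x <= y} -> set_surj setT setT G -> a <= b ->
  G a <= v <= G b -> exists2 x, a <= x <= b & G x = v.
Proof.
move=> Gh Gs ab /andP[av vb]; have [x _ xv] := Gs v I.
have [xa|ax] := ltP x a.
  by exists a; rewrite ?lexx //; apply/eqP; rewrite eq_le av -xv Gh // ltW.
have [bx|xb] := ltP b x; last by exists x; rewrite ?ax.
by exists b; rewrite ?lexx ?ab //; apply/eqP; rewrite eq_le vb -xv Gh // ltW.
Qed.

Section SameOrbit.
Variable R : realType.
Implicit Types x y z : R.

Lemma same_orbit_sym x y : same_orbit x y -> same_orbit y x.
Proof.
case=> [->|[x0 y0 [k yk]]]; first by left.
by right; split=> //; exists (- k); rewrite yk rmorphN /= addrK.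
Qed.

Lemma same_orbit_trans y x z : same_orbit x y -> same_orbit y z -> same_orbit x z.
Proof.
case=> [->//|[x0 y0 [k yk]]] [<-|[_ z0 [l zl]]]; right; split=> //; first by exists k.
by exists (k + l); rewrite rmorphD /= addrA -yk.
Qed.

Lemma same_orbit_intr x y : same_orbit x y -> exists k : int, x = y + k%:~R.
Proof.
by move=> /same_orbit_sym[->|[_ _ //]]; exists 0; rewrite addr0.
Qed.

Lemma same_orbit_ratr x (q : rat) : same_orbit x (ratr q) -> exists p : rat, x = ratr p.
Proof.
by move=> /same_orbit_intr[k ->]; exists (q + k%:~R); rewrite rmorphD /= ratr_int.
Qed.

(** The default value for codes that do not denote an evasive map. On [1, 3/2] the displacement lies
    strictly between 0 and 1. *)
Lemma half_evasive : evasive (fun x : R => x / 2).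
Proof.
split=> [x y xy|y _|]; first by lra.
  by exists (y * 2) => //; rewrite mulfK.
exists 1, (3 / 2); split=> [|x /andP[x1 x2]]; first by lra.
case=> [|[_ _ [k]]]; first by lra.
move=> xk; have : k%:~R < 0 :> R by lra.
have : (-1)%:~R < k%:~R :> R by rewrite rmorphN1; lra.
by rewrite ltr_int ltrz0; lia.
Qed.

End SameOrbit.

Lemma generic_set (R : realType) : exists X : set R,
  [/\ forall q : rat, X (ratr q), forall x y, same_orbit x y -> X x -> X y,
      X #= [set: nat -> bool] &
      forall G, evasive G -> exists x, X x /\ ~ X (G x)].
Proof.
have [lt [wf tri small]] := well_order_small_segments (nat -> bool).
have [D [Dev Dsurj]] : exists D : (nat -> bool) -> R -> R,
    (forall t, evasive (D t)) /\ forall G, evasive G -> exists t, D t = G.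
  exists (fun t => if `[< evasive (rational_sup t : R -> R) >]
                   then rational_sup t else fun x => x / 2); split=> [t|G Gev].
    by case: asboolP => // _; exact: half_evasive.
  have [t tG] := let: And3 Gh Gs _ := Gev in rational_sup_surj _ Gh Gs.
  by exists t; rewrite tG asboolT.
pose P a (A : set (R * R)) (v : R * R) := [/\ v.2 = D a v.1,
  ~ same_orbit v.1 v.2,
  forall q : rat, ~ same_orbit v.1 (ratr q) /\ ~ same_orbit v.2 (ratr q) &
  forall u, A u -> [/\ ~ same_orbit v.1 u.1, ~ same_orbit v.1 u.2 &
                       ~ same_orbit v.2 u.1]].
have [|h hP] := transfinite_choice _ _ _ P wf.
  move=> a h; apply: contrapT => none.
  have [Dh Ds [x0 [x1 [Dx01 Dx]]]] := Dev a.
  have [i [inj_i i01]] := sequences_inject_itv _ _ _ Dx01.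
  have x01 : x0 <= x1 by rewrite leNgt; apply/negP => /ltW/Dh; rewrite leNgt Dx01.
  (* Candidates are indexed by the image [y]. An earlier pair [u] spoils [y] when [y] is an integer
     shift of [u.1], or when its chosen preimage is an integer shift of [u.1] or [u.2]. *)
  pose hit (c : option bool) (k : int) (u : R * R) :=
    match c with
    | None => u.1 + k%:~R
    | Some e => D a ((if e then u.1 else u.2) + k%:~R)
    end.
  (* If every candidate fails, these countably many sets cover the range of [i], and by [koenig] one
     of them maps onto all binary sequences. Neither a singleton nor an image of the segment before
     [a] can do that. *)
  pose C (z : option bool * int + bool * rat) : set R :=
    match z with
    | inl (c, k) => [set hit c k (h b) | b in [set b | lt b a]]
    | inr (e, q) => [set if e then ratr q else D a (ratr q)]
    end.
  have [_ [f _ <-]|[[c k]|[e q]] [p ps]] := koenig _ _ _ _ C inj_i; last first.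
  - have [_ -> pt] := ps (fun=> true) I; have [_ -> pf] := ps (fun=> false) I.
    by have := congr1 (@^~ 0%N) (etrans (esym pt) pf).
  - apply: (small a (p \o hit c k \o h)) => t /ps [_ [b ba <-] <-].
    by exists b.
  have [x xin xy] := monotone_surj_IVT _ _ _ _ Dh Ds x01 (i01 f).
  apply: contrapT => nC; apply: none; exists (x, i f); split => /=.
  - by [].
  - by rewrite -xy; exact: Dx.
  - move=> q; split=> /same_orbit_ratr[r rE]; apply: nC.
      by exists (inr (false, r)); rewrite //= -xy rE.
    by exists (inr (true, r)); rewrite //= rE.
  move=> u [b ba <-]; split=> /same_orbit_intr[k kE]; apply: nC.
  - by exists (inl (Some true, k)) => //; exists b; rewrite //= -kE.
  - by exists (inl (Some false, k)) => //; exists b; rewrite //= -kE.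
  - by exists (inl (None, k)) => //; exists b; rewrite //= -kE.
exists [set x | (exists q : rat, x = ratr q) \/ exists a, same_orbit (h a).1 x].
split.
- by move=> q; left; exists q.
- move=> x y xy [[q xq]|[a ax]]; last by right; exists a; exact: same_orbit_trans xy.
  by left; move/same_orbit_sym: xy; rewrite xq => /same_orbit_ratr.
- rewrite card_eq_le card_real_le /=.
  apply/pcard_leP/injfunPex; exists (fun a => (h a).1).
    by move=> a _; right; exists a; left.
  move=> a b _ _ ab; apply: contrapT => /tri[|] /=.
    move=> ltab; have [_ _ _ /(_ (h a))[|+ _ _]] := hP b; first by exists a.
    by apply; rewrite ab; left.
  move=> ltba; have [_ _ _ /(_ (h b))[|+ _ _]] := hP a; first by exists b.
  by apply; rewrite ab; left.
move=> G /Dsurj[a DG]; exists (h a).1; split; first by right; exists a; left.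
have [e2 n12 nq nA] := hP a; rewrite -DG -e2 => -[[q hq]|[b ba]].
  by have [_] := nq q; apply; left.
have [ab|/tri[|]] := pselect (a = b); first by apply: n12; rewrite {1}ab.
  move=> ltab; have [_ _ _ /(_ (h a))[|_ n _]] := hP b; first by exists a.
  exact: n.
move=> ltba; have [|_ _ n] := nA (h b); first by exists b.
by apply: n; exact: same_orbit_sym.
Qed.

(** * Structure of the maps that are not evasive *)

Lemma increasing_enumeration (P : pred nat) :
  (forall n, exists2 m, (n < m)%N & P m) ->
  exists i : nat -> nat, [/\ i 0%N = 0%N, forall m, (i m < i m.+1)%N,
    forall m, P (i m.+1) & forall m j, (i m < j < i m.+1)%N -> ~~ P j].
Proof.
move=> Pinf.
have next n : exists m, (n < m)%N && P m.
  by have [m nm Pm] := Pinf n; exists m; rewrite nm.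
pose i := fix i m := if m is m'.+1 then ex_minn (next (i m')) else 0%N.
exists i; split=> // m.
- by rewrite /=; case: ex_minnP => j /andP[].
- by rewrite /=; case: ex_minnP => j /andP[].
move=> j /andP[ij]; rewrite /=; case: ex_minnP => k _ kmin.
by rewrite ltnNge; apply: contra => Pj; apply: kmin; rewrite ij.
Qed.

Section TameMaps.
Variables (R : realType) (G : R -> R).
Hypothesis Gh : {homo G : x y / x <= y}.
Hypothesis Gs : set_surj setT setT G.
Hypothesis tame : ~ evasive G.
Definition gap x := x - G x.

Lemma tame_orbit a b : G a < G b ->
  exists2 x, a <= x <= b & same_orbit x (G x).
Proof.
move=> ab; apply: contrapT => none; apply: tame; split=> //.
by exists a, b; split=> // x xab xo; apply: none; exists x.
Qed.

Lemma monotone_surj_continuous : continuous G.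
Proof.
move=> x; apply/cvgrPdist_le => e e0.
have [u _ ux] := Gs (G x - e) I; have [w _ wx] := Gs (G x + e) I.
have u_lt : u < x by rewrite ltNge; apply/negP => /Gh; rewrite ux; lra.
have lt_w : x < w by rewrite ltNge; apply/negP => /Gh; rewrite wx; lra.
near=> t; have ut : G u <= G t.
  by apply: Gh; apply: ltW; near: t; exact: lt_nbhsr.
have tw : G t <= G w.
  by apply: Gh; apply: ltW; near: t; exact: lt_nbhsl.
by rewrite ler_distlC; lra.
Unshelve. all: by end_near. Qed.

Lemma gap_IVT a b v : a <= b ->
  Num.min (gap a) (gap b) <= v <= Num.max (gap a) (gap b) ->
  exists2 x, a <= x <= b & gap x = v.
Proof.
move=> ab vab; have [|x] := IVT ab _ vab.
  apply: continuous_subspaceT => x; apply: cvgB => //.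
  exact: monotone_surj_continuous.
by rewrite in_itv /=; exists x.
Qed.

(** Orbits of negative points are singletons. If [G x] differed from [x], intermediate values would
    give an uncollapsed interval whose points and images lie on opposite sides of [x], so no point
    there could stay in its orbit. *)
Lemma tame_fix_neg x : x <= 0 -> G x = x.
Proof.
move=> x0; apply/eqP; case: (ltgtP (G x) x) => // Gx; exfalso.
  have [z _ zv] := Gs ((G x + x) / 2) I.
  have [|w /andP[xw /Gh wz] [wG|[_ Gw _]]] := @tame_orbit x z; lra.
have [z _ zv] := Gs ((x + G x * 2) / 3) I.
have [u _ uv] := Gs ((x * 2 + G x) / 3) I.
have zx : z < x by rewrite ltNge; apply/negP => /Gh; lra.
have [|w /andP[/Gh uw wz] [wG|[w0 _ _]]] := @tame_orbit u z; lra.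
Qed.

Lemma tame_ge0 x : 0 <= x -> 0 <= G x.
Proof. by move=> /Gh; rewrite (@tame_fix_neg 0). Qed.

Lemma intr_between (n k : int) :
  n%:~R < k%:~R :> R -> k%:~R < n%:~R + 1 :> R -> False.
Proof. by rewrite -[1]/(1%:~R) -rmorphD /= !ltr_int; lia. Qed.

Lemma tame_integral_gap a b : 0 <= a -> G a < G b ->
  exists2 x, a <= x <= b & exists k : int, gap x = k%:~R.
Proof.
move=> a0 /tame_orbit[x xab xo]; exists x => //; case: xo => [xG|[_ _ [k xG]]].
  by exists 0; rewrite /gap -xG subrr.
by exists (- k); rewrite /gap xG rmorphN /=; ring.
Qed.

(** The plateau through [x] fills all of [c, c + 1] with [c = G x + n]. If [G] varied between [x]
    and either end, an uncollapsed interval near [x] would have all gaps strictly between [n] and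
    [n + 1], whereas tameness forces an integral one. *)
Lemma tame_plateau x (n : int) : 0 <= x ->
  n%:~R < gap x -> gap x < n%:~R + 1 ->
  [/\ 0 <= G x + n%:~R, G (G x + n%:~R) = G x & G (G x + n%:~R + 1) = G x].
Proof.
move=> x0 nx xn; set c := G x + n%:~R.
have Dx : gap x = x - G x by [].
have cx : c < x by rewrite /c; lra.
have xc : x < c + 1 by rewrite /c; lra.
have left_flat : G (Num.max c 0) = G x.
  apply/eqP; rewrite eq_le Gh /=; last by rewrite ge_max x0 ltW.
  rewrite leNgt; apply/negP => lt.
  (* A value just below [G x]: above [G] at the left end, and so close that gaps remain under
     [n + 1]. *)
  pose v := (Num.max (G (Num.max c 0)) (x - n%:~R - 1) + G x) / 2.
  have v1 : G (Num.max c 0) < v /\ x - n%:~R - 1 < v.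
    by rewrite /v; case: (leP (G (Num.max c 0)) (x - n%:~R - 1)) => ?; lra.
  have v2 : v < G x.
    by rewrite /v; case: (leP (G (Num.max c 0)) (x - n%:~R - 1)) => ?; lra.
  have [z _ zv] := Gs v I.
  have zc : Num.max c 0 < z by rewrite ltNge; apply/negP => /Gh; lra.
  move: zc; rewrite gt_max => /andP[cz z0].
  have [||w /andP[zw wx] [k wk]] := @tame_integral_gap z x; [exact: ltW|lra|].
  have := Gh _ _ zw; have := Gh _ _ wx; move: wk; rewrite /gap => wk ? ?.
  by apply: (@intr_between n k); rewrite /c in cz; lra.
have right_flat : G (c + 1) = G x.
  apply/eqP; rewrite eq_le andbC Gh /=; last exact: ltW.
  rewrite leNgt; apply/negP => lt.
  pose v := (Num.min (G (c + 1)) (x - n%:~R) + G x) / 2.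
  have v1 : v < G (c + 1) /\ v < x - n%:~R.
    by rewrite /v; case: (leP (G (c + 1)) (x - n%:~R)) => ?; lra.
  have v2 : G x < v.
    by rewrite /v; case: (leP (G (c + 1)) (x - n%:~R)) => ?; lra.
  have [z _ zv] := Gs v I.
  have zc : z < c + 1 by rewrite ltNge; apply/negP => /Gh; lra.
  have [||w /andP[xw wz] [k wk]] := @tame_integral_gap x z; [by []|lra|].
  have := Gh _ _ xw; have := Gh _ _ wz; move: wk; rewrite /gap => wk ? ?.
  by apply: (@intr_between n k); rewrite /c in zc; lra.
(* Otherwise [G x = G 0 = 0], so [c] is the negative integer [n] and [x < n + 1 <= 0]. *)
have c0 : 0 <= c.
  rewrite leNgt; apply/negP => c_lt0; move: left_flat; rewrite max_r ?ltW //.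
  rewrite (@tame_fix_neg 0) // => Gx0; move: c_lt0 xc.
  rewrite /c -Gx0 add0r ltrz0 => n0; have : n + 1 <= 0 by lia.
  by rewrite -(ler_int R) rmorphD /=; lra.
by split=> //; rewrite max_l in left_flat.
Qed.

(** A drop of the gap would pass through a non-integral value, hence through a plateau [c, c + 1]
    strictly between [x] and [y], with gap the floor of [gap y] at [c]. As [c] is more than 1 closer
    to [x] than [y] is, induction on the distance gives [gap x <= gap c <= gap y]. *)
Lemma gap_homo x y : 0 <= x -> x <= y -> gap x <= gap y.
Proof.
move=> x0 xy; have [k yk] : exists k : nat, y <= x + k%:R.
  exists (Num.bound (y - x)); have := @archi_boundP _ (y - x).
  by rewrite subr_ge0 ltrBlDl => /(_ xy)/ltW.
elim: k => [|k IH] in x x0 y xy yk *; first by rewrite (_ : x = y) //; lra.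
rewrite leNgt; apply/negP => yx; pose n := Num.floor (gap y).
have /andP[ny yn] := floor_itv (gap y); rewrite -/n rmorphD /= in ny yn.
pose v := (gap y + Num.min (gap x) (n%:~R + 1)) / 2.
have [vy vx vn] : [/\ gap y < v, v < gap x & v < n%:~R + 1].
  by rewrite /v; case: (leP (gap x) (n%:~R + 1)) => ?; split; lra.
have [|z /andP[xz zy] zv] := @gap_IVT x y v xy.
  by rewrite ge_min le_max (ltW vy) (ltW vx) orbT.
have [|||_ Gc Gc1] := @tame_plateau z n; [lra|lra|lra|].
set c := G z + n%:~R in Gc Gc1 *.
have dz : gap z = z - G z by [].
have dc : gap c = n%:~R by rewrite /gap Gc /c; lra.
have cy : c + 1 < y.
  rewrite ltNge; apply/negP => /Gh yc; have := Gh _ _ zy.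
  by rewrite /gap in vy; lra.
have xc : x < c.
  rewrite ltNge; apply/negP => /Gh cx; have := Gh _ _ xz.
  by rewrite /gap in vx; lra.
have := IH x x0 c (ltW xc); rewrite -natr1 in yk.
by move=> /(_ ltac:(lra)); lra.
Qed.

Lemma gap_level (n : nat) x : 0 <= x -> n%:R < gap x ->
  exists c, [/\ 0 <= c, gap c = n%:R & gap (c + 1) = n.+1%:R].
Proof.
move=> x0 nx; pose v := (n%:R + Num.min (gap x) (n%:R + 1)) / 2.
have n0 : 0 <= n%:R :> R by [].
have [nv vn vx] : [/\ n%:R < v, v < n%:R + 1 & v < gap x].
  by rewrite /v; case: (leP (gap x) (n%:R + 1)) => ?; split; lra.
have [|z /andP[z0 zx] zv] := @gap_IVT 0 x v x0.
  rewrite ge_min le_max (ltW vx) orbT andbT; apply/orP; left.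
  by rewrite /gap tame_fix_neg // subrr; lra.
have [||c0 Gc Gc1] := @tame_plateau z n%:Z z0; rewrite ?zv //.
exists (G z + n%:R); split=> //.
  by rewrite /gap Gc; ring.
by rewrite /gap Gc1 -natr1; ring.
Qed.

(** By [gap_level], this ensures a plateau along which the gap climbs from [n] to [n + 1]. *)
Definition level (n : nat) := exists2 x, 0 <= x & n%:R < gap x.

Lemma level_le m n : (m <= n)%N -> level n -> level m.
Proof.
move=> mn [x x0 nx]; exists x => //.
by apply: le_lt_trans nx; rewrite ler_nat.
Qed.

(* Consecutive plateaus of unit length that touch are merged: block [m] starts
   at [s m] and consists of [i m.+1 - i m] of them. *)
Lemma tame_blocks : level 0 -> exists (i : nat -> nat) (s : nat -> R),
  [/\ i 0%N = 0%N, forall m, (i m < i m.+1)%N,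
    forall m, level (i m) ->
      [/\ 0 <= s m, gap (s m) = (i m)%:R &
          gap (s m + (i m.+1 - i m)%:R) = (i m.+1)%:R],
    forall m, level (i m.+1) -> s m + (i m.+1 - i m)%:R < s m.+1 &
    (forall m, level (i m)) \/
    exists M, forall m, level (i m) <-> (m <= M)%N].
Proof.
move=> lev0.
have /choice [c cP] : forall n, exists c, level n ->
    [/\ 0 <= c, gap c = n%:R & gap (c + 1) = n.+1%:R].
  move=> n; have [[x x0 nx]|] := pselect (level n); last by exists 0.
  by have [c] := gap_level _ _ x0 nx; exists c.
have c_step n : level n.+1 -> c n + 1 <= c n.+1.
  move=> ln; have [c0 c1 c2] := cP _ ln.
  have [d0 d1 d2] := cP _ (level_le _ _ (leqnSn n) ln).
  rewrite leNgt; apply/negP => cd; move: c1 c2 d1 d2; rewrite /gap -!natr1.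
  have [cd'|/ltW cd'] := leP (c n + 1) (c n.+1 + 1).
    by have := Gh _ _ cd'; lra.
  have := gap_homo (c n.+1 + 1) (c n + 1); rewrite /gap.
  by move=> /(_ ltac:(lra) cd'); lra.
(* An index without a plateau also counts as a break, so breaks remain unbounded when there are only
   finitely many plateaus. *)
pose brk n := `[< level n -> c n.-1 + 1 < c n >].
have [i [i0 iS ibrk inbrk]] : exists i : nat -> nat, [/\ i 0%N = 0%N,
    forall m, (i m < i m.+1)%N, forall m, brk (i m.+1) &
    forall m j, (i m < j < i m.+1)%N -> ~~ brk j].
  apply: increasing_enumeration => n; apply: contrapT => none.
  have nbrk m : (n < m)%N -> level m /\ c m = c m.-1 + 1.
    move=> nm; have nb : ~ (level m -> c m.-1 + 1 < c m).
      by move=> bm; apply: none; exists m => //; apply/asboolP.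
    have [lm|nl] := pselect (level m); last by case: nb.
    split=> //; apply/eqP; rewrite eq_le leNgt; apply/andP; split.
      by apply/negP => ?; apply: nb.
    by case: m nm lm {nb} => // m _ /c_step.
  have cn j : c (n + j)%N = c n + j%:R.
    elim: j => [|j IH]; first by rewrite addn0 addr0.
    have [|_ ->] := nbrk (n + j.+1)%N; first by lia.
    by rewrite addnS /= IH -natr1 addrA.
  have ln : level n by apply: level_le (nbrk n.+1 _).1.
  have [c0 cgap _] := cP n ln.
  (* Without later breaks the plateaus would tile a half-line, and [G] would never exceed its value
     [c n - n] at [c n]. *)
  have [x _ xv] := Gs (c n - n%:R + 1) I.
  pose j := Num.bound `|x|.
  have jx : x <= c (n + j.+1)%N.
    have := archi_boundP (normr_ge0 x); have := ler_norm x.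
    by rewrite cn -natr1 -/j; lra.
  have [_ gj _] := cP _ (nbrk (n + j.+1)%N ltac:(lia)).1.
  have := Gh _ _ jx; move: gj; rewrite /gap cn natrD; lra.
have i_ge m : (m <= i m)%N.
  by elim: m => // m IH; apply: leq_ltn_trans IH (iS m).
have i_mono m n : (m <= n)%N -> (i m <= i n)%N.
  elim: n => [|n IH]; first by rewrite leqn0 => /eqP->.
  by rewrite leq_eqVlt => /predU1P[->//|/IH/leq_trans]; apply; exact: ltnW.
have block m : level (i m) ->
    forall j, (i m + j < i m.+1)%N -> level (i m + j) /\ c (i m + j)%N = c (i m) + j%:R.
  move=> lm; elim=> [|j IH] jm; first by rewrite addn0 addr0.
  have [|lj cj] := IH; first by lia.
  have /asboolPn/not_implyP[lj' cj'] : ~~ brk (i m + j.+1)%N.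
    by apply: (inbrk m); rewrite jm andbT; lia.
  split=> //; apply/eqP; rewrite eq_le; apply/andP; split.
    by rewrite leNgt; apply/negP; rewrite addnS /= cj -natr1 addrA in cj' *.
  by move: lj'; rewrite addnS => /c_step; rewrite cj -natr1 addrA.
have block_end m : level (i m) -> exists j, [/\ level j, i m.+1 = j.+1 &
    c (i m) + (i m.+1 - i m)%:R = c j + 1].
  move=> lm; exists (i m.+1).-1; have im := iS m.
  have [|lj cj] := block m lm (i m.+1 - i m).-1; first by lia.
  have jE : (i m + (i m.+1 - i m).-1)%N = (i m.+1).-1 by lia.
  rewrite jE in lj cj; split=> //; first by lia.
  by rewrite cj -addrA natr1; congr (_ + _%:R); lia.
exists i, (c \o i); split=> //=.
- move=> m lm; have [c0 cg _] := cP _ lm; split=> //.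
  have [j [lj ij ->]] := block_end m lm.
  by have [_ _ ->] := cP _ lj; rewrite ij.
- move=> m lm; have [|j [lj ij ->]] := block_end m.
    exact: level_le (ltnW (iS m)) lm.
  by have /asboolP/(_ lm) := ibrk m; rewrite ij.
have [all|/existsNP[n nlev]] := pselect (forall n, level n).
  by left=> m; exact: all.
right; have ex : exists m, `[< ~ level (i m) >].
  by exists n; apply/asboolP => /(level_le _ _ (i_ge n)).
case: (ex_minnP ex) => -[|M] /asboolP nM Mmin; first by case: nM; rewrite i0.
exists M => m; split=> [lm|mM].
  rewrite leqNgt; apply/negP => Mm; apply: nM; exact: level_le (i_mono _ _ Mm) lm.
apply: contrapT => nm; have := Mmin m (introT (asboolP _) nm); lia.
Qed.

End TameMaps.

(** * Extension of epimorphisms to the line *)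

(** The extension takes suprema of [g] over the points of [X] up to [x]. Since [g] attains every
    rational, its values are dense, so the extension cannot jump over [v] at the supremum of the
    points where [g] is at most [v]. *)
Lemma epimorphism_extension {R : realType} (X : set R) (g : R -> R) :
  (forall q : rat, X (ratr q)) -> epimorphism X g ->
  exists G : R -> R, [/\ {homo G : x y / x <= y}, set_surj setT setT G &
    forall x, X x -> G x = g x].
Proof.
move=> Xrat [gX gsurj ghomo].
have gh x y : X x -> X y -> x <= y -> g x <= g y.
  by move=> Xx Xy; apply: ghomo; exact: mem_set.
have gval a b : a < b -> exists2 x, X x & a < g x < b.
  move=> /rat_in_itvoo[q]; rewrite in_itv /= => qab.
  by have [x Xx gxq] := gsurj _ (Xrat q); exists x; rewrite // gxq.
pose A x := [set g z | z in [set z | X z /\ z <= x]].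
have ubA x y : X y -> x <= y -> ubound (A x) (g y).
  by move=> Xy xy _ [z [Xz zx] <-]; apply: gh => //; exact: le_trans xy.
have ratA (x : R) : exists2 z, X z & x < z < x + 1.
  have /rat_in_itvoo[q] : x < x + 1 by lra.
  by rewrite in_itv /= => xq; exists (ratr q).
have nzA x : A x !=set0.
  have [z Xz /andP[_ zx]] := ratA (x - 1).
  by exists (g z), z => //; split=> //; lra.
have hubA x : has_ubound (A x).
  have [z Xz /andP[xz _]] := ratA x.
  by exists (g z); apply: ubA => //; exact: ltW.
have Gg x : X x -> sup (A x) = g x.
  move=> Xx; apply/eqP; rewrite eq_le ge_sup //=; last exact: ubA.
  by apply: ub_le_sup => //; exists x.
have Gh : {homo (fun x => sup (A x)) : x y / x <= y}.
  move=> x1 x2 xy; apply: ge_sup => // _ [z [Xz zx] <-].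
  by apply: ub_le_sup => //; exists z => //; split=> //; exact: le_trans xy.
exists (fun x => sup (A x)); split=> // v _.
pose B := [set x | X x /\ g x <= v].
have nzB : B !=set0.
  by have [x Xx /andP[_ gxv]] := gval (v - 1) v ltac:(lra); exists x; split=> //; exact: ltW.
have hubB : has_ubound B.
  have [y Xy /andP[vy _]] := gval v (v + 1) ltac:(lra); exists y => x [Xx xv].
  rewrite leNgt; apply/negP => /ltW/(gh _ _ Xy Xx); lra.
exists (sup B) => //; apply/eqP; rewrite eq_le; apply/andP; split.
  rewrite leNgt; apply/negP => /gval[x Xx /andP[vx xG]].
  have Bx : sup B <= x.
    apply: ge_sup => // y [Xy yv]; rewrite leNgt; apply/negP => /ltW xy.
    by have := gh _ _ Xx Xy xy; lra.
  by have := Gh _ _ Bx; rewrite (Gg x) //; lra.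
rewrite leNgt; apply/negP => /gval[x Xx /andP[Gx xv]].
have /Gh : x <= sup B by apply: ub_le_sup => //; split=> //; exact: ltW.
by rewrite (Gg x) //; lra.
Qed.

(** * The map [stall] and the maps generated from it *)

Definition stall {R : realType} (x : R) : R := Num.max (Num.min x 0) (x - 1).

Section Stall.
Variable R : realType.
Implicit Types x y : R.

Lemma stall_homo : {homo (@stall R) : x y / x <= y}.
Proof.
move=> x y xy; rewrite /stall ge_max !le_max; apply/andP; split; apply/orP.
  by left; rewrite le_min !ge_min xy lexx orbT.
by right; lra.
Qed.

Lemma stall_le0 x : x <= 0 -> stall x = x.
Proof. by move=> x0; rewrite /stall (min_l x0) max_l //; lra. Qed.

Lemma stall_itv01 x : 0 <= x -> x <= 1 -> stall x = 0.
Proof. by move=> x0 x1; rewrite /stall (min_r x0) max_l //; lra. Qed.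

Lemma stall_ge1 x : 1 <= x -> stall x = x - 1.
Proof. by move=> x1; rewrite /stall min_r ?max_r; lra. Qed.

Lemma iter_stall n x : n%:R <= x -> iter n stall x = x - n%:R.
Proof.
elim: n => [|n IH]; first by rewrite subr0.
by rewrite -natr1 => nx; rewrite iterS IH ?stall_ge1; lra.
Qed.

Lemma stall_epimorphism (X : set R) : X 0 ->
  (forall x y, same_orbit x y -> X x -> X y) -> epimorphism X stall.
Proof.
move=> X0 Xorb; split=> [x Xx|y Xy|x y _ _]; last exact: stall_homo.
  have [/stall_le0->//|x0] := leP x 0.
  have [x1|/ltW x1] := leP x 1; first by rewrite stall_itv01 // ltW.
  rewrite stall_ge1 //; apply: Xorb Xx; right; split; [lra|lra|].
  by exists (-1); rewrite rmorphN1.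
have [y0|y0] := leP y 0; first by exists y => //; exact: stall_le0.
exists (y + 1); last by rewrite stall_ge1; lra.
apply: Xorb Xy; right; split; [lra|lra|by exists 1].
Qed.

End Stall.

Lemma ereal_sup_pinfty {R : realType} (u : nat -> R) :
  (forall y, exists n, y <= u n) -> ereal_sup (range (fun n => (u n)%:E)) = +oo%E.
Proof.
move=> unb; set S := range _.
have uS n : ((u n)%:E <= ereal_sup S)%E by apply: ereal_sup_ubound; exists n.
case: (ereal_sup S) uS => [r uS|//|uS]; last by have := uS 0%N.
have [n rn] := unb (r + 1); have ur : u n <= r by rewrite -lee_fin.
by exfalso; lra.
Qed.

Lemma partial_sum_increments (i : nat -> nat) n :
  i 0%N = 0%N -> (forall m, i m <= i m.+1)%N ->
  partial_sum (fun m => i m.+1 - i m)%N n = i n.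
Proof.
move=> i0 iS; rewrite /partial_sum; elim: n => [|n IH]; first by rewrite big_ord0.
by rewrite big_ord_recr /= IH subnKC.
Qed.

Lemma tame_generated {R : realType} (X : set R) (g G : R -> R) :
  (forall q : rat, X (ratr q)) ->
  (forall x y, same_orbit x y -> X x -> X y) ->
  epimorphism X g -> {homo G : x y / x <= y} -> set_surj setT setT G ->
  ~ evasive G -> (forall x, X x -> G x = g x) -> level R G 0 ->
  upward_generated X stall g.
Proof.
move=> Xrat Xorb [gX _ _] Gh Gs tame Gg lev0.
have [i [s [i0 iS sP s_lt fin]]] := tame_blocks R G Gh Gs tame lev0.
have gap_le := gap_homo R G Gh Gs tame.
have Gge0 := tame_ge0 R G Gh Gs tame.
have Gneg := tame_fix_neg R G Gh Gs tame.
(* Block [m] is [s m, e m], made of [k m] unit plateaus; the partial sums of [k] telescope to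
   [i]. *)
pose k m := (i m.+1 - i m)%N.
pose e m := s m + (k m)%:R.
have k_gt0 m : (0 < k m)%N by rewrite /k subn_gt0.
have s_lt_e m : s m < e m by rewrite /e ltrDl ltr0n.
have KE n : partial_sum k n = i n.
  by apply: partial_sum_increments => // m; exact: ltnW.
have Ge m : level R G (i m) ->
    [/\ (i m)%:R <= s m, G (s m) = s m - (i m)%:R,
        G (e m) = s m - (i m)%:R & (i m.+1)%:R <= e m].
  move=> /sP[s0 gs ge]; have := Gge0 _ s0.
  have ke : (k m)%:R = (i m.+1)%:R - (i m)%:R :> R by rewrite /k natrB // ltnW.
  by move: gs ge; rewrite /gap -/(k m) -/(e m) /e ke => gs ge Gs0; split; lra.
(* A rational inside the block is sent by [g] into [X], at [s m - i m], which lies in the orbit of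
   [s m]. *)
have Xs m : level R G (i m) -> X (s m).
  move=> lm; have [is_ Gsm Gem _] := Ge m lm.
  have /rat_in_itvoo[q] := s_lt_e m; rewrite in_itv /= => /andP[/ltW sq /ltW qe].
  have : X (s m - (i m)%:R).
    have <- : G (ratr q) = s m - (i m)%:R.
      by apply/eqP; rewrite eq_le -{1}Gem -Gsm !Gh.
    by rewrite Gg //; exact: gX.
  apply: Xorb; right; split; [lra|by apply: le_trans is_|].
  by exists (i m)%:Z; rewrite -pmulrn subrK.
have Xe m : level R G (i m) -> X (e m).
  move=> lm; apply: Xorb (Xs m lm); have [s0 _ _] := sP m lm.
  by right; split=> //; [rewrite /e addr_ge0|exists (k m)%:Z].
have iter_s m : level R G (i m) -> iter (i m) stall (s m) = s m - (i m)%:R.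
  by move=> /Ge[? _ _ _]; rewrite iter_stall.
have iter_e m : level R G (i m) -> iter (k m) stall (e m) = s m.
  by move=> /sP[? _ _]; rewrite iter_stall /e ?addrK // lerDr.
have on_plateau m x : level R G (i m) -> X x -> s m <= x <= e m ->
    g x = iter (i m) stall (s m).
  move=> lm Xx /andP[sx xe]; have [_ Gsm Gem _] := Ge m lm.
  rewrite iter_s // -Gg //; apply/eqP; rewrite eq_le.
  by rewrite -{1}Gem -Gsm !Gh.
(* The gap has reached [i m.+1] at [e m] and is nondecreasing, so the upper bound makes it constant
   and [g] a shift. *)
have on_shift m x : level R G (i m) -> X x -> e m <= x ->
    gap R G x <= (i m.+1)%:R -> g x = iter (i m.+1) stall x.
  move=> lm Xx ex gx; have [_ _ _ ie] := Ge m lm; have [s0 _ ge] := sP m lm.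
  have e0 : 0 <= e m by apply: le_trans ie.
  have := gap_le _ _ e0 ex; rewrite ge -Gg // iter_stall; last exact: le_trans ex.
  by move: gx; rewrite /gap; lra.
have before x : X x -> x < s 0%N -> g x = x.
  move=> Xx xs; rewrite -Gg //; have [/Gneg//|/ltW x0] := leP x 0.
  have [_ + _] := sP 0%N (eq_ind_r (level R G) lev0 i0); rewrite i0 => gs.
  have := gap_le _ _ x0 (ltW xs); rewrite gs.
  have := gap_le _ _ (lexx 0) x0; rewrite /gap (Gneg 0) //; lra.
have s0_ge0 : 0 <= s 0%N.
  by have [] := sP 0%N (eq_ind_r (level R G) lev0 i0).
have nat_sup : ereal_sup (range (fun n : nat => (n%:R : R)%:E)) = +oo%E.
  apply: ereal_sup_pinfty => y; exists (Num.bound `|y|).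
  by have := archi_boundP (normr_ge0 y); have := ler_norm y; lra.
pose b j := if odd j then e j./2 else s j./2.
have b2 n : b (2 * n)%N = s n by rewrite /b mul2n odd_double doubleK.
have b2S n : b (2 * n).+1 = e n.
  by rewrite /b mul2n /= odd_double /= uphalf_double.
have b2SS n : b (2 * n).+2 = s n.+1.
  by rewrite (_ : (2 * n).+2 = 2 * n.+1)%N ?b2 //; lia.
have b2P j : (exists n, j = 2 * n)%N \/ (exists n, j = (2 * n).+1)%N.
  have := odd_double_half j; rewrite -mul2n; case: (odd j) => jE.
    by right; exists j./2; rewrite -{1}jE.
  by left; exists j./2; rewrite -{1}jE.
have bX j : level R G (i j./2) -> X (b j) /\ 0 <= b j.
  move=> lj; have [s0 _ _] := sP _ lj.
  rewrite /b; case: (odd j); split=> //; [exact: Xe|exact: addr_ge0|exact: Xs].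
have b_lt j : level R G (i j.+1./2) -> b j < b j.+1.
  case: (b2P j) => -[n ->]; first by rewrite b2S b2.
  by rewrite b2S b2SS -[(_.+1)./2]/((2 * n)./2.+1) mul2n doubleK; exact: s_lt.
have covered x j : s 0%N <= x -> x < b j -> exists2 l, (l < j)%N & b l <= x <= b l.+1.
  move=> sx; elim: j => [|j IH]; first by rewrite ltNge sx.
  have [xb _|bx xb] := ltP x (b j); last by exists j; rewrite ?bx ?ltW.
  by have [l lj lx] := IH xb; exists l => //; exact: ltnW.
have i_ge m : (m <= i m)%N.
  by elim: m => // m IH; apply: leq_ltn_trans IH (iS m).
have s_unbounded x m : level R G (i m) -> `|x| <= m%:R -> x <= s m.
  move=> /Ge[im _ _ _] xm; apply: le_trans (ler_norm x) (le_trans xm _).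
  by apply: le_trans im; rewrite ler_nat.
(* The backward orbit 0, 1, 2, ... makes the supremum infinite. *)
exists (fun n => n%:R); rewrite nat_sup; split.
- by move=> n; rewrite -(ratr_nat R).
- by move=> n; rewrite ltr_nat.
- by move=> n; rewrite stall_ge1 -natr1 ?addrK // lerDr.
case: fin => [inf|[M lM]].
  left; exists b, k => /=; split; [|split; [|split; [|split; [|split; [|split; [|split]]]]]].
  - by move=> j; exact/b_lt/inf.
  - by move=> j; have [Xb b0] := bX j (inf _); rewrite ltry.
  - by [].
  - by move=> n; rewrite addn1 b2S b2; exact: iter_e.
  (* The values in question are [G (s n)], unbounded because [G] is onto and the [s n] are
     cofinal. *)
  - apply: ereal_sup_pinfty => y; have [x _ <-] := Gs y I.
    exists (Num.bound `|x|); rewrite KE b2 iter_s //.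
    have [_ <- _ _] := Ge _ (inf (Num.bound `|x|)).
    exact/Gh/s_unbounded/ltW/archi_boundP.
  - move=> x Xx nx; have [/(before _ Xx)//|sx] := ltP x (s 0%N).
    case: nx; pose m := Num.bound `|x + 1|.
    have xm : x + 1 <= s m by exact/s_unbounded/ltW/archi_boundP.
    have [|l _ lx] := covered x (2 * m)%N sx; first by rewrite b2; lra.
    by exists l.
  - move=> n x Xx; rewrite addn1 b2 b2S KE; exact: on_plateau.
  - move=> n x Xx; rewrite addn1 addn2 b2S b2SS KE => /andP[ex xs].
    apply: on_shift => //; have [_ <- _] := sP n.+1 (inf n.+1).
    apply: gap_le xs; apply: le_trans ex; have [_ _ _] := Ge n (inf n).
    exact: le_trans.
right; exists M.+1, b, k => /=.
have lev j : (j < 2 * M.+1)%N -> level R G (i j./2) by move=> jM; apply/lM; lia.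
split; [|split; [|split; [|split; [|split; [|split; [|split]]]]]].
- by [].
- by move=> j jM; apply/b_lt/lev.
- by move=> j /lev /bX[Xb b0]; rewrite ltry.
- by [].
- by move=> n nM; rewrite addn1 b2S b2; apply/iter_e/lM.
- move=> x Xx nx; have [/(before _ Xx)//|sx] := ltP x (s 0%N).
  case: nx; have [xe|ex] := ltP x (e M).
    have [|l lM' lx] := covered x (2 * M).+1 sx; first by rewrite b2S.
    by exists l; rewrite ?ifT ?lee_fin //; lia.
  exists (2 * M).+1; first by lia.
  by rewrite ifT ?ifF ?b2S ?lee_fin ?ex ?leey //; lia.
- move=> n x nM Xx; rewrite addn1 !ifT; [|lia|lia].
  by rewrite b2 b2S KE !lee_fin; apply: on_plateau => //; exact/lM.
- move=> n x nM Xx; rewrite addn1 addn2 ifT; last by lia.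
  have ln : level R G (i n) by exact/lM.
  rewrite b2S KE lee_fin => /andP[ex xs].
  have x0 : 0 <= x.
    by apply: le_trans ex; have [_ _ _] := Ge n ln; exact: le_trans.
  apply: on_shift => //; have [nM'|Mn] := ltnP n M.
    have ln1 : level R G (i n.+1) by exact/lM.
    move: xs; rewrite ifT; last by lia.
    by rewrite b2SS lee_fin; have [_ <- _] := sP n.+1 ln1; exact: gap_le.
  (* Beyond the last block a larger gap would yield one more block. *)
  rewrite leNgt; apply/negP => xi.
  have /lM : level R G (i n.+1) by exists x.
  by lia.
Qed.

(** * Rigidity and conclusion *)

Lemma tame_nonid_level {R : realType} (G : R -> R) (x : R) :
  {homo G : x y / x <= y} -> set_surj setT setT G -> ~ evasive G ->
  G x <> x -> level R G 0.
Proof.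
move=> Gh Gs tame Gx; have [/(tame_fix_neg R G Gh Gs tame)//|/ltW x0] := leP x 0.
exists x => //; have := gap_homo R G Gh Gs tame _ _ (lexx 0) x0.
rewrite {1}/gap (tame_fix_neg R G Gh Gs tame) // subrr le_eqVlt => /predU1P[gx|//].
by case: Gx; apply/esym/eqP; rewrite -subr_eq0 -/(gap R G x) -gx.
Qed.

Theorem theorem3p2 (R : realType) :
  exists (X : set R) (f : R -> R),
    dense X /\
    X #= [set: nat -> bool] /\
    epimorphism X f /\ ~ {in X, f =1 id} /\
    automorphism_rigid X /\
    (forall g : R -> R,
       epimorphism X g -> ~ {in X, g =1 id} -> generated_wide X f g).
Proof.
have [X [Xrat Xorb Xcard Xgen]] := generic_set R.
have Xnat n : X n%:R by rewrite -(ratr_nat R).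
have extend g : epimorphism X g -> ~ {in X, g =1 id} -> exists G : R -> R,
    [/\ {homo G : x y / x <= y}, set_surj setT setT G, ~ evasive G,
        forall x, X x -> G x = g x & level R G 0].
  move=> epi nid; have [G [Gh Gs Gg]] := epimorphism_extension X g Xrat epi.
  (* An evasive extension would send some point of [X] out of [X], although it agrees there with
     [g]. *)
  have tame : ~ evasive G.
    by move=> /Xgen[x [Xx]]; rewrite Gg //; apply; have [gX _ _] := epi; exact: gX.
  exists G; split=> //; apply: contrapT => nlev; apply: nid => x /set_mem Xx.
  by apply: contrapT; rewrite -Gg // => /(tame_nonid_level _ _ Gh Gs tame).
exists X, stall; split; [|split; [|split; [|split; [|split]]]].
- move=> O O0 Oo; have [x [Ox [q _ qx]]] := @dense_rat R O O0 Oo.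
  by exists x; rewrite -qx in Ox *.
- by [].
- by apply: stall_epimorphism => //; exact: (Xnat 0%N).
- move=> /(_ 1); rewrite stall_itv01 //= => /(_ (mem_set _)) nid.
  suff : 0 = 1 :> R by move=> /eqP; rewrite eq_sym oner_eq0.
  by apply: nid; exact: (Xnat 1%N).
- move=> h [[hX hinj hsurj] hmono]; apply: contrapT => nid.
  have [|G [Gh Gs tame Gg lev0]] := extend h _ nid.
    by split=> // x y Xx Xy xy; rewrite hmono.
  have [x x0 gx] := lev0.
  (* The first plateau contains two rationals [p < q], which the injective [h] would have to
     identify. *)
  have [c [_ gc gc1]] := gap_level R G Gh Gs tame _ _ x0 gx.
  have /rat_in_itvoo[p] : c < c + 1 by lra.
  rewrite in_itv /= => /andP[cp /[dup] pc1 /rat_in_itvoo[q]].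
  rewrite in_itv /= => /andP[pq qc1].
  have : h (ratr q) <= h (ratr p).
    rewrite -!Gg //; have := Gh _ _ (ltW cp); have := Gh _ _ (ltW qc1).
    by move: gc gc1; rewrite /gap; lra.
  by rewrite hmono ?mem_set // leNgt pq.
- move=> g epi nid; left; have [G [Gh Gs tame Gg lev0]] := extend g epi nid.
  exact: (tame_generated _ _ G).
Qed.
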